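(* Let $\mathbb{F}_q$ be a finite field and let $\alpha \in \mathbb{F}_q^{\ast}$. If $X, Y \subseteq \operatorname{Mat}_2(\mathbb{F}_q)$ satisfy $\sqrt{|X||Y|} > \frac{2q^3\sqrt{q}}{q-1}$, then there exist $M \in X$ and $N \in Y$ such that $\det(M-N) = \alpha$. In particular, if $X \subseteq \operatorname{Mat}_2(\mathbb{F}_q)$ satisfies $|X| > \frac{2q^3\sqrt{q}}{q-1}$, then $X$ contains two distinct matrices whose difference has determinant $\alpha$.
   Context: $\operatorname{Mat}_2(\mathbb{F}_q)$ denotes the ring of $2\times 2$ matrices over the finite field $\mathbb{F}_q$ with $q$ elements. *)

(* Defs.v *)
From mathcomp Require Import all_boot all_order all_algebra all_field.
Set Implicit Arguments. Unset Strict Implicit. Unset Printing Implicit Defensive.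

(* Main.v *)
Require Import Defs.
From mathcomp Require Import all_boot all_order all_algebra all_field.
From mathcomp Require Import fingroup pgroup abelian character classfun.
From mathcomp Require Import zify ring.
Set Implicit Arguments. Unset Strict Implicit. Unset Printing Implicit Defensive.
Import Order.TTheory GRing.Theory Num.Theory.
Local Open Scope ring_scope.

(* If no pair (M, N) in X x Y has det (M - N) = alpha, Fourier inversion on
   Mat_2(F_q) bounds |SL_2| sqrt(|X||Y|) by q^4 times the largest nontrivial
   Fourier coefficient of the set {det = alpha}. That coefficient is -q at
   matrices of rank 1 and q times a Kloosterman sum K at invertible ones, so all
   rests on Weil's bound |K| <= 2 sqrt q. A Stepanov argument gives
   |K| <= 2 q sqrt Q + 2 q + 1 over any large enough extension of F_q whose
   order Q is a square, and passing to a quadratic extension turns K into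
   2 Q - K^2, so that a violation of Weil's bound would be amplified beyond the
   Stepanov estimate. *)

(** Weil's bound is reached without zeta functions. The map (sum, product) on pairs from [E] and the
    map (trace, norm) on its quadratic extension together hit every target exactly twice, which
    gives the Hasse-Davenport relation in degree 2. If [K^2 = Q (4 + x)] with [x >= 0], the next sum
    has square at least [Q^2 (4 + 4 x)], so the excess quadruples at each level, and the Stepanov
    error relative to [sqrt Q] must stay bounded up the tower. It does because all characters of the
    tower are invariant under [y -> y^q] for the original [q]: the auxiliary curves
    [x + a / x = y^q - y + g] keep the same degree in [y] at every level. Functions on such a curve
    are handled without a function field. A combination of powers of a root of [X^2 - u X + a] is
    tested through antisymmetric expressions in the two roots, divided by their difference; the
    quotients are polynomials in [u] and [a] in every characteristic, 2 included. This is where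
    Lucas sequences come from. *)

(** * Lucas sequences and their degrees *)

Section Lucas.
Variable R : comNzRingType.
Implicit Types (u a x y : R).

(** Two consecutive terms are carried so that the second-order recurrence becomes structural. The
    sequence is [(x^n - y^n) / (x - y)] for the roots of [X^2 - u X + a], but it needs neither the
    roots nor the division. *)
Fixpoint lucas_pair u a n : R * R :=
  if n is m.+1 then
    let: (v, w) := lucas_pair u a m in (w, u * w - a * v)
  else (0, 1).

Definition lucas u a n := (lucas_pair u a n).1.

Lemma lucas0 u a : lucas u a 0 = 0. Proof. by []. Qed.

Lemma lucas1 u a : lucas u a 1 = 1. Proof. by []. Qed.

Lemma lucasSS u a n : lucas u a n.+2 = u * lucas u a n.+1 - a * lucas u a n.
Proof. by rewrite /lucas /=; case: (lucas_pair u a n). Qed.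

Lemma lucas_ind (P : nat -> Prop) :
  P 0%N -> P 1%N -> (forall n, P n -> P n.+1 -> P n.+2) -> forall n, P n.
Proof.
move=> P0 P1 PSS n; suff [] : P n /\ P n.+1 by [].
by elim: n => // n [Pn PSn]; split=> //; apply: PSS.
Qed.

Lemma lucas_binet x y n :
  (x - y) * lucas (x + y) (x * y) n = x ^+ n - y ^+ n.
Proof.
elim/lucas_ind: n => [||n IH0 IH1]; first by rewrite lucas0; ring.
  by rewrite lucas1; ring.
rewrite lucasSS mulrBr mulrCA IH1 mulrCA IH0 !exprS; ring.
Qed.

(* For [u = x + y], [a = x * y]: the quotient of [x^n y^m - y^n x^m] by [x - y]. *)
Definition lucas2 u a n m :=
  if (m <= n)%N then a ^+ m * lucas u a (n - m)
  else - (a ^+ n * lucas u a (m - n)).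

Lemma lucas2_binet x y n m :
  (x - y) * lucas2 (x + y) (x * y) n m = x ^+ n * y ^+ m - y ^+ n * x ^+ m.
Proof.
rewrite /lucas2; case: leqP => [le_mn | /ltnW le_nm].
  rewrite mulrCA lucas_binet -{3 4}(subnKC le_mn) exprMn !exprD; ring.
rewrite mulrN mulrCA lucas_binet -{3 4}(subnKC le_nm) exprMn !exprD; ring.
Qed.

Lemma lucas20 u a n : lucas2 u a n 0 = lucas u a n.
Proof. by rewrite /lucas2 mul1r subn0. Qed.

Lemma lucas2SS u a n m :
  lucas2 u a n m.+2 = u * lucas2 u a n m.+1 - a * lucas2 u a n m.
Proof.
rewrite /lucas2; case: (ltngtP n m) => [lt_nm||->].
- have -> : (m.+2 <= n)%N = false by lia.
  rewrite !subSn ?(ltnW lt_nm) ?leqW 1?ltnW // lucasSS; ring.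
- rewrite leq_eqVlt => /predU1P[<-|lt_mn].
    have -> : (m.+2 <= m.+1)%N = false by lia.
    rewrite subnn subSn // subSnn subnn lucas0 !lucas1 exprS; ring.
  rewrite lt_mn.
  have -> : (n - m = (n - m.+2).+2)%N by lia.
  have -> : (n - m.+1 = (n - m.+2).+1)%N by lia.
  by rewrite lucasSS !exprS; ring.
have -> : (m.+2 <= m)%N = false by lia.
rewrite ?leqnn subnn !subSn ?leqnSn // subnn lucas0 lucasSS lucas1 lucas0; ring.
Qed.

End Lucas.

Lemma rmorph_lucas (R S : comNzRingType) (f : {rmorphism R -> S}) u a n :
  f (lucas u a n) = lucas (f u) (f a) n.
Proof.
elim/lucas_ind: n => [||n IH0 IH1]; rewrite ?rmorph0 ?rmorph1 //.
by rewrite !lucasSS rmorphB !rmorphM IH0 IH1.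
Qed.

Lemma rmorph_lucas2 (R S : comNzRingType) (f : {rmorphism R -> S}) u a n m :
  f (lucas2 u a n m) = lucas2 (f u) (f a) n m.
Proof.
by rewrite /lucas2; case: leqP => _; rewrite ?rmorphN !rmorphM rmorphXn rmorph_lucas.
Qed.

Lemma size_lucas (F : fieldType) (u : {poly F}) (a : F) e n :
  (0 < e)%N -> size u = e.+1 -> size (lucas u a%:P n.+1) = (e * n).+1.
Proof.
move=> e_gt0 szu.
have szM (v : {poly F}) k : size v = k.+1 -> size (u * v) = (e + k).+1.
  move=> szv; rewrite size_mul -?size_poly_eq0 ?szu ?szv //; lia.
elim/lucas_ind: n => [||n IH0 IH1]; first by rewrite lucas1 size_poly1 muln0.
  by rewrite lucasSS lucas1 lucas0 mulr0 subr0 mulr1 szu muln1.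
rewrite lucasSS size_polyDl (szM _ _ IH1) ?mulnS //.
rewrite size_polyN mul_polyC; apply: leq_ltn_trans (size_scale_leq _ _) _.
by rewrite IH0; lia.
Qed.

Lemma size_lucas2_le (F : fieldType) (u : {poly F}) (a : F) e n m s :
    (0 < e)%N -> size u = e.+1 ->
    ((m < n -> e * (n - m).-1 < s) -> (n < m -> e * (m - n).-1 < s) ->
  size (lucas2 u a%:P n m) <= s)%N.
Proof.
move=> e_gt0 szu lt_mn lt_nm; rewrite /lucas2.
have szU k c : (size (c%:P * lucas u a%:P k.+1)%R <= (e * k).+1)%N.
  by rewrite mul_polyC (leq_trans (size_scale_leq _ _)) // (size_lucas _ _ _ szu).
case: (ltngtP n m) => [nm|mn|->].
- rewrite size_polyN -rmorphXn; case: (m - n)%N (lt_nm nm) (subn_gt0 n m) => [|k] //.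
    by rewrite nm.
  by move=> lek _; apply: leq_trans (szU _ _) _.
- rewrite -rmorphXn; case: (n - m)%N (lt_mn mn) (subn_gt0 m n) => [|k] //.
    by rewrite mn.
  by move=> lek _; apply: leq_trans (szU _ _) _.
by rewrite subnn mulr0 size_poly0.
Qed.

(** * Linear relations between polynomials and vanishing of Lucas sums *)

(** The linear algebra of Stepanov's method: [n] unknown scalars face only [s1 + s2] coefficient
    equations. *)
Lemma poly_relation2 (F : fieldType) n s1 s2 (P1 P2 : 'I_n -> {poly F}) :
    (forall t, size (P1 t) <= s1)%N -> (forall t, size (P2 t) <= s2)%N ->
    (s1 + s2 < n)%N ->
  exists2 d : 'I_n -> F, exists t, d t != 0 &
    \sum_t d t *: P1 t = 0 /\ \sum_t d t *: P2 t = 0.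
Proof.
move=> sz1 sz2 lt_sn.
pose A := \matrix_(t < n) row_mx (poly_rV (P1 t) : 'rV_s1) (poly_rV (P2 t) : 'rV_s2).
have: kermx A != 0.
  rewrite kermx_eq0 -row_leq_rank -ltnNge.
  exact: leq_ltn_trans (rank_leq_col _) lt_sn.
case/rowV0Pn => v /sub_kermxP vA v_neq0.
exists (v 0).
  by case/rV0Pn: v_neq0 => t; exists t.
have vA0 j : \sum_t v 0 t * A t j = 0 by move/rowP/(_ j): vA; rewrite !mxE.
have coefD (P : 'I_n -> {poly F}) i : (\sum_t v 0 t *: P t)`_i = \sum_t v 0 t * (P t)`_i.
  by rewrite coef_sum; apply: eq_bigr => t _; rewrite coefZ.
split; apply/polyP => i; rewrite coefD coef0.
  case: (ltnP i s1) => [lt_i|le_i].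
    apply: etrans (vA0 (lshift s2 (Ordinal lt_i))); apply: eq_bigr => t _.
    by rewrite mxE row_mxEl mxE.
  by rewrite big1 // => t _; rewrite nth_default ?mulr0 // (leq_trans (sz1 t)).
case: (ltnP i s2) => [lt_i|le_i].
  apply: etrans (vA0 (rshift s1 (Ordinal lt_i))); apply: eq_bigr => t _.
  by rewrite mxE row_mxEr mxE.
by rewrite big1 // => t _; rewrite nth_default ?mulr0 // (leq_trans (sz2 t)).
Qed.

Lemma size_Xn_lucas2_le (F : fieldType) (u : {poly F}) (a : F) e b n m s :
    (0 < e)%N -> size u = e.+1 ->
    ((m < n -> b + e * (n - m).-1 < s) -> (n < m -> b + e * (m - n).-1 < s) ->
  size ('X^b * lucas2 u a%:P n m)%R <= s)%N.
Proof.
move=> e_gt0 szu lt_mn lt_nm.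
have [->|v_neq0] := eqVneq (lucas2 u a%:P n m) 0; first by rewrite mulr0 size_poly0.
have szv : (size (lucas2 u a%:P n m) <= s - b)%N.
  by apply: size_lucas2_le szu _ _ => // [/lt_mn|/lt_nm]; lia.
rewrite size_monicM ?monicXn // size_polyXn.
by move: szv v_neq0; rewrite -size_poly_gt0; lia.
Qed.

Lemma poly_size_free (F : fieldType) n (P : 'I_n -> {poly F}) (c : 'I_n -> F) :
    (forall t, size (P t) = t.+1) -> \sum_t c t *: P t = 0 ->
  forall t, c t = 0.
Proof.
move=> szP sum0 t0; apply/eqP; apply/negP => /negP ct0.
case: (@arg_maxnP _ t0 (fun t => c t != 0) val ct0) => t /= ct tmax.
suff: (\sum_t c t *: P t)`_t != 0 by rewrite sum0 coef0 eqxx.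
rewrite coef_sum (bigD1 t) //= big1 ?addr0 => [|i ne_it].
  rewrite coefZ mulf_neq0 //.
  have /= <- : (size (P t)).-1 = t by rewrite szP.
  by rewrite -/(lead_coef _) lead_coef_eq0 -size_poly_eq0 szP.
rewrite coefZ; have [->|ci] := eqVneq (c i) 0; first by rewrite mul0r.
rewrite (@nth_default _ _ (P i)) ?mulr0 // szP ltn_neqAle (inj_eq val_inj) ne_it.
exact: tmax.
Qed.

Lemma expr_sum_pchar (R : comNzRingType) (I : finType) (c : I -> R) r :
  [pchar R].-nat r -> (\sum_i c i) ^+ r = \sum_i c i ^+ r.
Proof.
move=> rP; have /andP[r_gt0 _] := rP.
elim/big_rec2: _ => [|i x y _ <-]; first by rewrite expr0n gtn_eqF.
by rewrite exprDn_pchar.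
Qed.

Section LucasSums.
Variables (R : idomainType) (I : finType) (c : I -> R) (n : I -> nat).

Lemma lucas2_sum_binet x y m :
  (x - y) * (\sum_i c i * lucas2 (x + y) (x * y) (n i) m) =
  (\sum_i c i * x ^+ n i) * y ^+ m - (\sum_i c i * y ^+ n i) * x ^+ m.
Proof.
rewrite mulr_sumr !mulr_suml -sumrB; apply: eq_bigr => i _.
by rewrite mulrCA lucas2_binet; ring.
Qed.

(** With [f] and [g] the sums of powers of [x] and of [y], the hypotheses say that [f y^k = g x^k]
    for [k = m] and [k = m + 1]; eliminating [g] leaves [f y^m (y - x) = 0]. *)
Lemma lucas2_sum_eq0 x y m : x != y -> x * y != 0 ->
    \sum_i c i * lucas2 (x + y) (x * y) (n i) m = 0 ->
    \sum_i c i * lucas2 (x + y) (x * y) (n i) m.+1 = 0 ->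
  \sum_i c i * x ^+ n i = 0.
Proof.
move=> ne_xy; rewrite mulf_eq0 => /norP[_ y_neq0] s0 s1; apply/eqP.
have := lucas2_sum_binet x y m; have := lucas2_sum_binet x y m.+1.
rewrite s0 s1 !mulr0; set f := \sum_i _; set g := \sum_i _ => e1 e0.
have: f * (y ^+ m * (y - x)) = 0.
  rewrite [LHS](_ : _ = (f * y ^+ m.+1 - g * x ^+ m.+1) - (f * y ^+ m - g * x ^+ m) * x).
    by rewrite -e0 -e1 mul0r subr0.
  by rewrite !exprS; ring.
move/eqP; rewrite !mulf_eq0 expf_eq0 (negPf y_neq0) andbF subr_eq0.
by rewrite [y == x]eq_sym (negPf ne_xy) !orbF.
Qed.

(** As [a] is nonzero, the recurrence in [m] runs backwards and carries two consecutive zeros down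
    to [m = 0]. No roots are involved, so this applies over [{poly E}]. *)
Lemma lucas_sum_eq0 u a m : a != 0 ->
    \sum_i c i * lucas2 u a (n i) m = 0 ->
    \sum_i c i * lucas2 u a (n i) m.+1 = 0 ->
  \sum_i c i * lucas u a (n i) = 0.
Proof.
move=> a_neq0; elim: m => [|m IHm] s0 s1.
  by rewrite -[RHS]s0; apply: eq_bigr => i _; rewrite lucas20.
apply: IHm => //; apply: (mulfI a_neq0); rewrite mulr0.
rewrite [LHS](_ : _ = u * (\sum_i c i * lucas2 u a (n i) m.+1) -
                      \sum_i c i * lucas2 u a (n i) m.+2).
  by rewrite s0 s1 mulr0 subrr.
rewrite !mulr_sumr -sumrB; apply: eq_bigr => i _; rewrite lucas2SS; ring.
Qed.

End LucasSums.

Lemma horner_Xn_lucas2_sum (R : comNzRingType) (I : finType) (c : I -> R)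
    (b n : I -> nat) (u : {poly R}) (a x y z : R) m :
    x + y = u.[z] -> x * y = a ->
  (\sum_i c i *: ('X^(b i) * lucas2 u a%:P (n i) m)).[z] =
  \sum_i c i * z ^+ b i * lucas2 (x + y) (x * y) (n i) m.
Proof.
move=> -> ->; rewrite horner_sum; apply: eq_bigr => i _.
rewrite hornerZ hornerM hornerXn mulrA; congr (_ * _).
rewrite -[LHS]/(horner_eval z _) rmorph_lucas2; congr lucas2; exact: hornerC.
Qed.

(** * Stepanov's method on the curve [X^2 - u X + a = 0] *)

(** The ordinates with two distinct rational points above them. Double points are left out, since
    the method divides by the difference of the roots. *)
Definition split_fibres (E : finFieldType) (u : {poly E}) (a : E) :=
  [set y | [exists x1, exists x2, [&& x1 != x2, x1 + x2 == u.[y] & x1 * x2 == a]]].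

Section Stepanov.
Variables (E : finFieldType) (a : E) (u : {poly E}) (e l r : nat).
Hypotheses (a_neq0 : a != 0) (e_gt0 : (0 < e)%N) (szu : size u = e.+1).
Hypotheses (l_gt1 : (1 < l)%N) (rE : r = (e * l)%N).
Hypotheses (r_pchar : [pchar E].-nat r) (cardE : #|E| = (r ^ 2)%N).

Let r_gt0 : (0 < r)%N. Proof. by rewrite rE muln_gt0 e_gt0 ltnW. Qed.

Let N := (r * (r + e))%N.
(* [j1 t] and [j2 t] are the two digits of [t] in base [r], and each of them is
   split further in base [e], so that [Y^i X^k] has weight [i + e k]. *)
Let j1 (t : nat) := (t %% r)%N.
Let j2 (t : nat) := (t %/ r)%N.
(** [bg], [ng] are the exponents of [(Y^i X^k)^r Y^i' X^k'], the two monomials having weights [j1 t]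
    and [j2 t]. The [r]-th power followed by [z^(r^2) = z] on [E] moves the factor [r] from the
    first monomial to the second, as in [bh], [nh]. *)
Let bg t := (r * (j1 t %% e) + j2 t %% e)%N.
Let ng t := (r * (j1 t %/ e) + j2 t %/ e)%N.
Let bh t := (j1 t %% e + r * (j2 t %% e))%N.
(** The successor keeps the index positive: [lucas] vanishes at 0, while the freeness argument needs
    a term of size exactly [t.+1] for each [t]. *)
Let nh t := (j1 t %/ e + r * (j2 t %/ e)).+1.
Let mg := (e * 'C(l, 2))%N.
(** [e * mh] is about half of [r * r]: degrees that run up to [N] are lowered by it to fit in [sh],
    and the terms of index below [mh] fit in the same bound. *)
Let mh := (e * l * l).+1./2.
Let sh := ((r * r)./2 + r * e)%N.

Let eq_mg : (2 * (e * mg) + r * e = r * r)%N.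
Proof.
have := mul_bin_diag l 1; rewrite bin1 /mg rE; case: l l_gt1 => // k _ /=.
nia.
Qed.

Let mh_bounds : (r * r <= 2 * (e * mh) <= r * r + e)%N.
Proof. rewrite /mh rE; nia. Qed.

Let digits t : (t < N)%N -> exists A B C D : nat,
  (j1 t %/ e = A /\ j1 t %% e = B /\ j2 t %/ e = C /\ j2 t %% e = D)%N /\
  (B < e /\ D < e /\ e * A + B < r /\ e * C + D < r + e /\
      t = r * (e * C + D) + (e * A + B))%N.
Proof.
move=> lt_t; exists (j1 t %/ e)%N, (j1 t %% e)%N, (j2 t %/ e)%N, (j2 t %% e)%N.
split=> //; rewrite !ltn_pmod // ![(e * _)%N]mulnC -!divn_eq; do 2!split=> //; split.
  exact: ltn_pmod.
split; last by rewrite mulnC -divn_eq.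
by rewrite ltn_divLR // mulnC.
Qed.

Let size_g t m : (t < N)%N -> m = mg \/ m = mg.+1 ->
  (size ('X^(bg t) * lucas2 u a%:P (ng t) m)%R <= r * r - e * m)%N.
Proof.
move=> /digits[A [B [C [D [[eA [eB [eC eD]]] [ltB [ltD [ltAB [ltCD _]]]]]]]]] Dm.
rewrite /bg /ng eA eB eC eD.
have e2r : (2 * e <= r)%N by rewrite rE mulnC leq_mul2l l_gt1 orbT.
have em : (e * m <= e * mg + e)%N by case: Dm => ->; rewrite ?mulnS; lia.
apply: (size_Xn_lucas2_le _ _ szu) => // [lt_m|lt_n].
  have e1 : (e * (r * A + C - m).-1 + e * m + e = r * (e * A) + e * C)%N.
    have : (e * ((r * A + C - m).-1 + m + 1) = e * (r * A + C))%N.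
      by congr (_ * _)%N; lia.
    lia.
  have e2 : (r * (e * A + B).+1 <= r * r)%N by rewrite leq_mul2l ltAB orbT.
  lia.
have e1 : (e * (m - (r * A + C)).-1 + e <= e * m)%N.
  by rewrite addnC -mulnS leq_mul2l; apply/orP; right; lia.
have e2 : (r * B.+1 <= r * e)%N by rewrite leq_mul2l ltB orbT.
lia.
Qed.

Let size_h t m : (t < N)%N -> m = mh \/ m = mh.+1 ->
  (size ('X^(bh t) * lucas2 u a%:P (nh t) m)%R <= sh)%N.
Proof.
move=> /[dup] lt_t /digits[A [B [C [D [[eA [eB [eC eD]]] [ltB [ltD [ltAB [ltCD Dt]]]]]]]]] Dm.
rewrite /bh /nh eA eB eC eD.
have e2r : (2 * e <= r)%N by rewrite rE mulnC leq_mul2l l_gt1 orbT.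
have em : (e * mh <= e * m <= e * mh + e)%N by case: Dm => ->; rewrite ?mulnS; lia.
have hr := odd_double_half (r * r); rewrite /sh.
apply: (size_Xn_lucas2_le _ _ szu) => // [lt_m|lt_n].
  have e1 : (e * ((A + r * C).+1 - m).-1 + e * m = e * A + r * (e * C))%N.
    have : (e * (((A + r * C).+1 - m).-1 + m) = e * (A + r * C))%N.
      by congr (_ * _)%N; lia.
    lia.
  move: lt_t; rewrite /N; lia.
have e1 : (e * (m - (A + r * C).+1).-1 + 2 * e <= e * m)%N.
  by rewrite [(2 * e)%N]mulnC -mulnDr leq_mul2l; apply/orP; right; lia.
have e2 : (r * D.+1 <= r * e)%N by rewrite leq_mul2l ltD orbT.
lia.
Qed.

(* A combination [G] of the [Y^(bg t) X^(ng t)] vanishing on the curve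
   [X^2 - u X + a = 0]: [G = 0] there follows from the vanishing of
   [G(X) X'^m - G(X') X^m] for two consecutive [m], [X' = u - X] being the
   conjugate of [X]; [mg] is chosen to balance the degrees of these. *)
Let relation : exists2 d : 'I_N -> E, exists t, d t != 0 &
  forall m, m = mg \/ m = mg.+1 ->
    \sum_t d t *: ('X^(bg t) * lucas2 u a%:P (ng t) m) = 0.
Proof.
have e2r : (2 * e <= r)%N by rewrite rE mulnC leq_mul2l l_gt1 orbT.
case: (@poly_relation2 _ N (r * r - e * mg) (r * r - e * mg.+1)
  (fun t => 'X^(bg t) * lucas2 u a%:P (ng t) mg)
  (fun t => 'X^(bg t) * lucas2 u a%:P (ng t) mg.+1)) => [t|t||d d_neq0 [d0 d1]].
- by apply: size_g; [|left].
- by apply: size_g; [|right].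
(* By [eq_mg] the two sizes add up to [N - e], short of the [N] unknowns. *)
- by rewrite /N mulnS; lia.
by exists d => // m [] ->.
Qed.

(* Raising [G] to the power [r] and reducing [Y^(r^2)] to [Y] and [X^(r^2)] to [X]
   gives, up to a factor [X], a function of lower degree vanishing at the rational
   points; it is not zero since its terms have distinct degrees. *)
Let free_h (d : 'I_N -> E) : (exists t, d t != 0) ->
  exists2 m, m = mh \/ m = mh.+1 &
    \sum_t d t ^+ r *: ('X^(bh t) * lucas2 u a%:P (nh t) m) != 0.
Proof.
move=> [t0 dt0].
have [s0|?] := eqVneq (\sum_t d t ^+ r *: ('X^(bh t) * lucas2 u a%:P (nh t) mh)) 0;
  last by exists mh; [left|].
have [s1|?] := eqVneq (\sum_t d t ^+ r *: ('X^(bh t) * lucas2 u a%:P (nh t) mh.+1)) 0;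
  last by exists mh.+1; [right|].
have scaleE m : \sum_t d t ^+ r *: ('X^(bh t) * lucas2 u a%:P (nh t) m) =
    \sum_t (d t ^+ r)%:P * 'X^(bh t) * lucas2 u a%:P (nh t) m.
  by apply: eq_bigr => t _; rewrite -mul_polyC mulrA.
have := @lucas_sum_eq0 _ _ (fun t => (d t ^+ r)%:P * 'X^(bh t)) nh u a%:P mh.
rewrite polyC_eq0 -!scaleE s0 s1 => /(_ a_neq0 erefl erefl) sum0.
have: \sum_t d t ^+ r *: ('X^(bh t) * lucas u a%:P (nh t)) = 0.
  by rewrite -[RHS]sum0; apply: eq_bigr => t _; rewrite -mul_polyC mulrA.
move/poly_size_free => /(_ _ t0) dr0; case/negP: dt0.
suff: d t0 ^+ r == 0 by rewrite expf_eq0 r_gt0.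
rewrite dr0 // => t.
(* The degree is [bh t + e * (nh t).-1], in which the digits reassemble to [t]. *)
rewrite size_monicM ?monicXn // -?size_poly_gt0 ?(size_lucas _ _ e_gt0 szu) // size_polyXn.
have [A [B [C [D [[eA [eB [eC eD]]] [_ [_ [_ [_ Dt]]]]]]]]] := digits (ltn_ord t).
by rewrite Dt /bh /nh -Dt eA eB eC eD; lia.
Qed.

(** Over a split [y] both roots lie in [E], so the reduced function vanishes at each of them and [y]
    is a root of the nonzero [h], whose size is at most [sh]. *)
Lemma stepanov_bound : (2 * #|split_fibres u a| <= r * r + 2 * (r * e))%N.
Proof.
set S := split_fibres u a.
have [d /free_h [m Dm h_neq0] gd0] := relation.
set h := \sum_t _ in h_neq0.
suff rootS : all (root h) (enum S).
  have := max_poly_roots h_neq0 rootS (enum_uniq S); rewrite -fintype.cardE.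
  have : (size h <= sh)%N.
    apply: leq_trans (size_sum _ _ _) _; apply/bigmax_leqP => t _.
    by apply: leq_trans (size_scale_leq _ _) _; apply: size_h.
  have := odd_double_half (r * r); rewrite /sh; move: #|S| (size h) => k1 k2; lia.
apply/allP => y; rewrite mem_enum inE.
case/existsP=> x1 /existsP[x2 /and3P[ne_x /eqP sum_x /eqP prod_x]].
have g0 x1' x2' : x1' != x2' -> x1' + x2' = u.[y] -> x1' * x2' = a ->
    \sum_t d t ^+ r * y ^+ bh t * x1' ^+ nh t = 0.
  move=> ne' sum' prod'.
  have: \sum_t d t * y ^+ bg t * x1' ^+ ng t = 0.
    apply: (@lucas2_sum_eq0 _ _ _ _ _ x2' mg) => //; first by rewrite prod'.
      by rewrite -(horner_Xn_lucas2_sum _ _ _ _ sum' prod') gd0 ?horner0 //; left.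
    by rewrite -(horner_Xn_lucas2_sum _ _ _ _ sum' prod') gd0 ?horner0 //; right.
  move/(congr1 (fun z => x1' * z ^+ r)); rewrite expr_sum_pchar // expr0n gtn_eqF //.
  rewrite mulr0 mulr_sumr => s0; rewrite -[RHS]s0; apply: eq_bigr => t _.
  have frob (z : E) k k' : z ^+ (r * k + k') ^+ r = z ^+ (k + r * k').
    rewrite -exprM mulnDl exprD mulnAC (mulnC k') exprM mulnn -cardE expf_card.
    by rewrite exprD.
  by rewrite !exprMn !frob exprS; ring.
apply/rootP; rewrite (horner_Xn_lucas2_sum _ _ _ _ sum_x prod_x).
have /mulfI : x1 - x2 != 0 by rewrite subr_eq0.
apply; rewrite lucas2_sum_binet mulr0 (g0 x1 x2) //.
rewrite (g0 x2 x1) ?mul0r ?subrr // 1?eq_sym // ?(addrC x2) ?(mulrC x2) //.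
Qed.

End Stepanov.

(** * Additive characters and Kloosterman sums *)

Definition additive_character (E : finFieldType) (psi : E -> algC) :=
  [/\ {morph psi : x y / x + y >-> x * y}, forall x, `|psi x| = 1
    & exists x, psi x != 1].

Definition kloosterman (E : finFieldType) (psi : E -> algC) (a : E) :=
  \sum_(x | x != 0) psi (x + a / x).

Section AdditiveCharacter.
Variables (E : finFieldType) (psi : E -> algC).
Hypothesis psiP : additive_character psi.

Lemma addcharD x y : psi (x + y) = psi x * psi y.
Proof. by case: psiP => ->. Qed.

Lemma addchar_norm x : `|psi x| = 1.
Proof. by case: psiP. Qed.

Lemma addchar_neq0 x : psi x != 0.
Proof. by rewrite -normr_eq0 addchar_norm oner_eq0. Qed.

Lemma addchar0 : psi 0 = 1.
Proof. by apply: (mulfI (addchar_neq0 0)); rewrite -addcharD addr0 mulr1. Qed.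

Lemma addcharN x : psi (- x) = (psi x)^*.
Proof.
apply: (mulfI (addchar_neq0 x)).
by rewrite -addcharD subrr addchar0 -normCK addchar_norm expr1n.
Qed.

Lemma sum_addchar (V : finZmodType) (f : V -> E) :
  {morph f : v w / v + w} ->
  (exists v, psi (f v) != 1) -> \sum_v psi (f v) = 0.
Proof.
move=> fD [v0 psi_v0]; have: (psi (f v0) - 1) * \sum_v psi (f v) = 0.
  rewrite mulrBl mul1r {2}(reindex_inj (addrI v0)) mulr_sumr.
  by apply/eqP; rewrite subr_eq0; apply/eqP/eq_bigr => v _; rewrite fD addcharD.
by move/eqP; rewrite mulf_eq0 subr_eq0 (negPf psi_v0) => /eqP.
Qed.

Lemma sum_addcharM c : \sum_x psi (c * x) = (#|E| * (c == 0))%:R.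
Proof.
have [->|c_neq0] := eqVneq c 0.
  under eq_bigr do rewrite mul0r addchar0.
  by rewrite sumr_const muln1 -mulr_natr mul1r.
rewrite muln0 mulr0n; apply: (sum_addchar (f := *%R c)) (mulrDr c) _.
by case: psiP => _ _ [x psi_x]; exists (x / c); rewrite mulrC divfK.
Qed.

Lemma sum_addchar_id : \sum_x psi x = 0.
Proof.
by have := sum_addcharM 1; rewrite oner_eq0 muln0; under eq_bigr do rewrite mul1r.
Qed.

Lemma kloosterman_real a : kloosterman psi a \is Num.real.
Proof.
apply/CrealP; rewrite rmorph_sum [RHS](reindex_inj oppr_inj) /=.
apply: eq_big => [x|x _]; first by rewrite oppr_eq0.
by rewrite -addcharN opprD invrN mulrN.
Qed.

End AdditiveCharacter.

(** * The Stepanov estimate for Kloosterman sums, through Artin-Schreier type curves *)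

Section KloostermanStepanov.
Variables (E : finFieldType) (a : E) (e l r : nat).
Hypotheses (a_neq0 : a != 0) (e_gt1 : (1 < e)%N).
Hypotheses (l_gt1 : (1 < l)%N) (rE : r = (e * l)%N).
Hypotheses (r_pchar : [pchar E].-nat r) (cardE : #|E| = (r ^ 2)%N).

Let u g : {poly E} := 'X^e - 'X + g%:P.

Let size_u g : size (u g) = e.+1.
Proof.
rewrite /u -addrA size_polyDl size_polyXn //; apply: leq_ltn_trans (size_polyD _ _) _.
rewrite size_polyN size_polyX gtn_max ltnS e_gt1 /=.
by apply: leq_ltn_trans (size_polyC_leq1 _) _; apply: ltnW.
Qed.

Let fibre g y := [set x | (x != 0) && (x + a / x == (u g).[y])].

(** The fibre consists of roots of [X^2 - (u g).[y] X + a]. Without two distinct roots in [E] only a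
    double root remains, which forces the discriminant to vanish at [y], in characteristic 2 as
    well. *)
Let card_fibre g y :
  (#|fibre g y| <= 2 * (y \in split_fibres (u g) a) + (root (u g ^+ 2 - (4 * a)%:P) y))%N.
Proof.
case: (boolP (y \in _)) => [|ySn].
  rewrite inE => /existsP[x1 /existsP[x2 /and3P[_ /eqP s /eqP p]]].
  rewrite muln1; apply: leq_trans (leq_addr _ _).
  apply: leq_trans (_ : #|[set x1; x2]| <= 2)%N; last by rewrite cards2; case: eqP.
  apply/subset_leq_card/subsetP => x; rewrite !inE => /andP[x_neq0 /eqP e1].
  have: (x - x1) * (x - x2) = 0.
    by rewrite [LHS](_ : _ = x ^+ 2 - (x1 + x2) * x + x1 * x2); [rewrite s p -e1; field | ring].
  by move/eqP; rewrite mulf_eq0 !subr_eq0.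
rewrite muln0 add0n.
have dbl x : x \in fibre g y -> (u g).[y] = x + x /\ a = x * x.
  rewrite inE => /andP[x_neq0 /eqP e1].
  have p : x * (a / x) = a by rewrite mulrC divfK.
  have [e2|ne] := eqVneq x (a / x); first by split; rewrite -?e1 -?[LHS]p -!e2.
  case/negP: ySn; rewrite inE; apply/existsP; exists x; apply/existsP; exists (a / x).
  by rewrite ne e1 p !eqxx.
have [->|[x xf]] := set_0Vmem (fibre g y); first by rewrite cards0.
have [ux ax] := dbl x xf.
have -> : root (u g ^+ 2 - (4 * a)%:P) y.
  by apply/rootP; rewrite hornerD hornerN hornerC horner_exp ux ax; ring.
rewrite -[true : nat](cards1 x); apply/subset_leq_card/subsetP => x' /dbl[].
rewrite ux ax => e1 e2; rewrite inE -subr_eq0 -[_ == 0]/((0 < 2)%N && _) -expf_eq0.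
apply/eqP; rewrite [LHS](_ : _ = x' * x' - (x + x) * x' + x * x); last ring.
by rewrite e1 e2; ring.
Qed.

Let sum_fibre g : (\sum_y #|fibre g y| <= r * r + 2 * (r * e) + 2 * e)%N.
Proof.
pose D y : nat := root (u g ^+ 2 - (4 * a)%:P) y.
apply: (@leq_trans (\sum_y (2 * (y \in split_fibres (u g) a) + D y))%N).
  by apply: leq_sum => y _; apply: card_fibre.
rewrite big_split -big_distrr /= leq_add //.
  rewrite -big_mkcond sum1_card; apply: stepanov_bound rE _ _ => //.
  exact: ltnW.
set P := u g ^+ 2 - (4 * a)%:P; have szP : size P = (2 * e).+1.
  have szu2 : size (u g ^+ 2) = (2 * e).+1.
    have /eqP := size_exp (u g) 2; rewrite size_u /= mulnC => /eqP <-.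
    by rewrite prednK // size_poly_gt0 expf_neq0 // -size_poly_eq0 size_u.
  rewrite size_polyDl szu2 // size_polyN.
  by apply: leq_ltn_trans (size_polyC_leq1 _) _; lia.
have P_neq0 : P != 0 by rewrite -size_poly_eq0 szP.
have := max_poly_roots P_neq0 (_ : all (root P) (enum [pred y | root P y])) (enum_uniq _).
rewrite szP ltnS -fintype.cardE -sum1_card big_mkcond /=; apply.
by apply/allP => y; rewrite mem_enum.

Qed.

(* Summing over [g] the number of points of [x + a / x = y^e - y + g] against
   [psi g] gives [#|E|] times the Kloosterman sum, because [psi (y^e - y) = 1];
   subtracting a constant from these numbers does not change the result, so their
   upper bound and their total suffice. *)
Lemma kloosterman_stepanov psi : additive_character psi ->
    (forall y, psi (y ^+ e) = psi y) ->
  `|kloosterman psi a| <= (2 * (r * e) + 2 * e + 1)%:R.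
Proof.
move=> psiP psi_e; have Q_gt0 : 0 < (#|E|%:R : algC) by rewrite ltr0n (cardD1 0).
pose M g := (\sum_y #|fibre g y|)%N; pose B := (r * r + 2 * (r * e) + 2 * e)%N.
have fibreE x y g : (x \in fibre g y) = (x != 0) && (g == x + a / x - (y ^+ e - y)).
  rewrite inE /u !hornerE; congr (_ && _).
  by rewrite [RHS]eq_sym subr_eq [g + _]addrC.
have sumM (f : E -> algC) : \sum_g f g * (M g)%:R =
    \sum_(x | x != 0) \sum_y f (x + a / x - (y ^+ e - y)).
  transitivity (\sum_g \sum_y \sum_(x in fibre g y) f g).
    apply: eq_bigr => g _; rewrite natr_sum mulr_sumr; apply: eq_bigr => y _.
    by rewrite sumr_const mulr_natr.
  rewrite exchange_big /= [RHS]exchange_big; apply: eq_bigr => y _.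
  transitivity (\sum_g \sum_(x | x != 0)
      if g == x + a / x - (y ^+ e - y) then f g else 0).
    apply: eq_bigr => g _; rewrite -big_mkcondr.
    by apply: eq_bigl => x; rewrite fibreE.
  rewrite exchange_big; apply: eq_bigr => x _ /=.
  by rewrite -big_mkcond big_pred1_eq.
have sumM1 : \sum_g (M g)%:R = (#|E|%:R - 1) * #|E|%:R :> algC.
  have := sumM (fun=> 1); under eq_bigr do rewrite mul1r; move=> ->.
  under eq_bigr do rewrite sumr_const.
  rewrite sumr_const; have -> : #|[pred x : E | x != 0]| = #|E|.-1 := cardC1 0.
  by rewrite -[LHS]mulr_natl -subn1 natrB //; apply/card_gt0P; exists 0.
have sumMpsi : \sum_g psi g * (M g)%:R = #|E|%:R * kloosterman psi a.
  rewrite sumM mulr_sumr; apply: eq_bigr => x _.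
  rewrite -[#|E|%:R]sumr_const mulr_suml; apply: eq_bigr => y _.
  have psi1 : psi (y ^+ e - y) = 1 by rewrite addcharD // psi_e -addcharD // subrr addchar0.
  by rewrite mul1r (addcharD psiP (x + a / x)) (addcharN psiP) psi1 conjC1 mulr1.
rewrite -(ler_pM2l Q_gt0) -{1}(ger0_norm (ltW Q_gt0)) -normrM -sumMpsi.
have -> : \sum_g psi g * (M g)%:R = - \sum_g psi g * (B - M g)%:R.
  have := sum_addchar_id psiP; move/(congr1 ( *%R^~ B%:R)); rewrite mul0r mulr_suml => sB.
  transitivity (\sum_g psi g * (M g)%:R - \sum_g psi g * B%:R); first by rewrite sB subr0.
  rewrite -sumrB -sumrN; apply: eq_bigr => g _.
  by rewrite natrB ?sum_fibre // mulrBr opprB.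
rewrite normrN; apply: le_trans (ler_norm_sum _ _ _) _.
under eq_bigr do rewrite normrM addchar_norm // mul1r normr_nat natrB ?sum_fibre //.
(* The gaps [B - M g] total [Q * B - Q * (Q - 1)] with [Q = r^2], which is [Q] times the announced
   bound. *)
rewrite sumrB sumM1 sumr_const /B cardE -mulr_natl natrX !natrD !natrM.
rewrite le_eqVlt; apply/orP; left; apply/eqP; ring.
Qed.

End KloostermanStepanov.

(** * Kloosterman sums over a quadratic extension *)

Lemma sum_fibres (I J : finType) (h : I -> J) (g : J -> algC) :
  \sum_i g (h i) = \sum_j #|[set i | h i == j]|%:R * g j.
Proof.
rewrite (partition_big h predT) //=; apply: eq_bigr => j _.
rewrite (eq_bigr (fun=> g j)) => [|i /eqP-> //].
by rewrite sumr_const mulr_natl; congr (_ *+ _); apply: eq_card => i; rewrite inE.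
Qed.

Section QuadraticExtension.
Variables (E L : finFieldType) (i : {rmorphism E -> L}).
Hypotheses (cardL : #|L| = (#|E| ^ 2)%N) (E_pchar : [pchar L].-nat #|E|).
Local Notation Q := #|E|.

(** [X^Q - X] has at most [Q] roots, and the image of [E] already supplies [Q] of them. *)
Lemma frob_fixed z : z ^+ Q = z -> exists x, i x = z.
Proof.
move=> zQ; pose P : {poly L} := 'X^Q - 'X.
have Q_gt1 : (1 < Q)%N := finNzRing_gt1 E.
have szP : size P = Q.+1.
  by rewrite size_polyDl ?size_polyXn // size_polyN size_polyX ltnS.
have P_neq0 : P != 0 by rewrite -size_poly_eq0 szP.
have rootP w : root P w = (w ^+ Q == w).
  by rewrite /root /P hornerD hornerN hornerXn hornerX subr_eq0.
have [/imageP[x _ ->]|zN] := boolP (z \in image i predT); first by exists x.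
have roots_s : all (root P) (z :: image i predT).
  apply/allP => w; rewrite inE rootP => /predU1P[->|]; first by rewrite zQ.
  by case/imageP=> x _ ->; rewrite -rmorphXn expf_card.
have uniq_s : uniq (z :: image i predT).
  by rewrite /= zN map_inj_uniq ?enum_uniq //; apply: fmorph_inj.
have := max_poly_roots P_neq0 roots_s uniq_s.
by rewrite szP /= size_image ltnn.
Qed.

Lemma frobD (x y : L) : (x + y) ^+ Q = x ^+ Q + y ^+ Q.
Proof. exact: exprDn_pchar. Qed.

Lemma frobK (z : L) : (z ^+ Q) ^+ Q = z.
Proof. by rewrite -exprM mulnn -cardL expf_card. Qed.

Lemma frob_rmorph x : i x ^+ Q = i x.
Proof. by rewrite -rmorphXn expf_card. Qed.

(** The inverse of [i] on its image; the default 0 is never reached for traces and norms, which are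
    fixed by Frobenius. *)
Definition descent z : E := odflt 0 [pick x | i x == z].

Lemma descentK z : z ^+ Q = z -> i (descent z) = z.
Proof.
move=> /frob_fixed[x ix]; rewrite /descent; case: pickP => [y /eqP //|/(_ x)].
by rewrite ix eqxx.
Qed.

Definition trace2 z := descent (z + z ^+ Q).
Definition norm2 z := descent (z * z ^+ Q).

Lemma trace2E z : i (trace2 z) = z + z ^+ Q.
Proof. by rewrite descentK // frobD frobK addrC. Qed.

Lemma norm2E z : i (norm2 z) = z * z ^+ Q.
Proof. by rewrite descentK // exprMn frobK mulrC. Qed.

Lemma trace2D z w : trace2 (z + w) = trace2 z + trace2 w.
Proof. by apply: (fmorph_inj i); rewrite rmorphD !trace2E frobD; ring. Qed.

Lemma norm2_eq0 z : (norm2 z == 0) = (z == 0).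
Proof.
rewrite -(fmorph_eq0 i) norm2E mulf_eq0 expf_eq0.
by case: (z == 0); rewrite ?andbF.
Qed.

Lemma trace2_kloosterman z a : z != 0 ->
  trace2 (z + i a / z) = trace2 z + a * trace2 z / norm2 z.
Proof.
move=> z_neq0; apply: (fmorph_inj i).
rewrite rmorphD fmorph_div rmorphM !trace2E norm2E frobD exprMn exprVn frob_rmorph.
by field; rewrite z_neq0 expf_neq0.
Qed.

(** For [w = (s, n)], the roots of [X^2 - s X + n] are either distinct in [E] (two ordered pairs),
    or conjugate outside [E] (two elements of [L]), or equal (one of each kind). *)
Let split_pairs w := [set p : E * E | (p.1 + p.2, p.1 * p.2) == w].
Let conj_pairs w := [set z | (trace2 z, norm2 z) == w].

Let card_pairs_le w : (#|split_pairs w| + #|conj_pairs w| <= 2)%N.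
Proof.
have quad (R : fieldType) (x y x' y' : R) : x + y = x' + y' -> x * y = x' * y' ->
    x' = x /\ y' = y \/ x' = y /\ y' = x.
  move=> s p; have: (x' - x) * (x' - y) = 0.
    rewrite [LHS](_ : _ = x' ^+ 2 - (x + y) * x' + x * y); last ring.
    by rewrite s p; ring.
  move/eqP; rewrite mulf_eq0 !subr_eq0 => /orP[]/eqP e; [left|right]; split=> //.
    by apply: (addrI x'); rewrite -s e.
  by apply: (addrI x'); rewrite -s e addrC.
have pairP p : p \in split_pairs w -> forall p', p' \in split_pairs w ->
    p' = p \/ p' = (p.2, p.1).
  case: p => x y; rewrite inE => /eqP Dw [x' y']; rewrite inE -Dw => /eqP[/= s q].
  by have [[-> ->]|[-> ->]] := quad _ x y x' y' (esym s) (esym q); [left|right].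
have conjP z : z \in conj_pairs w -> forall z', z' \in conj_pairs w ->
    z' = z \/ z' = z ^+ Q.
  rewrite inE => /eqP Dw z'; rewrite inE -Dw => /eqP[/(congr1 i) s /(congr1 i) q].
  rewrite !trace2E !norm2E in s q.
  by have [[-> _]|[-> _]] := quad _ z _ z' _ (esym s) (esym q); [left|right].
have [->|[z zC]] := set_0Vmem (conj_pairs w).
  rewrite cards0 addn0; have [->|[p pS]] := set_0Vmem (split_pairs w).
    by rewrite cards0.
  apply: leq_trans (_ : #|[set p; (p.2, p.1)]| <= 2)%N; last by rewrite cards2; case: eqP.
  by apply/subset_leq_card/subsetP => p' /(pairP _ pS)[]->; rewrite !inE eqxx ?orbT.
have [->|[p pS]] := set_0Vmem (split_pairs w).
  rewrite cards0; apply: leq_trans (_ : #|[set z; z ^+ Q]| <= 2)%N;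
    last by rewrite cards2; case: eqP.
  by apply/subset_leq_card/subsetP => z' /(conjP _ zC)[]->; rewrite !inE eqxx ?orbT.
have [ip1 ip2 zQ] : [/\ i p.1 = z, i p.2 = z & z ^+ Q = z].
  move: zC pS; rewrite !inE => /eqP<- /eqP[/(congr1 i) s /(congr1 i) q].
  rewrite trace2E norm2E rmorphD rmorphM in s q.
  by have [[-> e2]|[-> e2]] := quad _ _ _ _ _ s q; move: e2; rewrite frob_rmorph.
apply: (@leq_trans (#|[set p]| + #|[set z]|)); last by rewrite !cards1.
rewrite leq_add //; apply/subset_leq_card/subsetP.
  move=> p' /(pairP _ pS); have p12 : p.1 = p.2 by apply: (fmorph_inj i); rewrite ip1 ip2.
  by rewrite inE => -[]->//; rewrite [X in _ == X]surjective_pairing p12.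
by move=> z' /(conjP _ zC); rewrite zQ inE => -[]->.
Qed.

(* Equality is forced by the total: both families have [#|E|^2] members. *)
Let card_pairs w : (#|split_pairs w| + #|conj_pairs w| = 2)%N.
Proof.
have sum_card (I : finType) (h : I -> E * E) : (\sum_w #|[set j | h j == w]| = #|I|)%N.
  rewrite -sum1_card (partition_big h predT) //=; apply: eq_bigr => w' _.
  by rewrite -sum1_card; apply: eq_bigl => j; rewrite inE.
have: (\sum_w (2 - (#|split_pairs w| + #|conj_pairs w|)) == 0)%N.
  rewrite sumnB => [|? _]; last exact: card_pairs_le.
  rewrite big_split /= !sum_card sum_nat_const card_prod cardL.
  by rewrite mulnn muln2 addnn subnn.
rewrite sum_nat_eq0 => /forallP/(_ w) /=; rewrite subn_eq0 => le2.
by apply/eqP; rewrite eqn_leq le2 card_pairs_le.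
Qed.

Let sum_pairs (g : E * E -> algC) :
  \sum_p g (p.1 + p.2, p.1 * p.2) + \sum_z g (trace2 z, norm2 z) = 2 * \sum_w g w.
Proof.
rewrite (sum_fibres (fun p : E * E => (p.1 + p.2, p.1 * p.2))).
rewrite (sum_fibres (fun z => (trace2 z, norm2 z))) -big_split mulr_sumr.
apply: eq_bigr => w _ /=; rewrite -mulrDl -natrD; congr (_%:R * _).
exact: card_pairs.
Qed.

Variable psi : E -> algC.
Hypothesis psiP : additive_character psi.

Lemma trace2_addchar : additive_character (psi \o trace2).
Proof.
split=> [z w|z|] /=; first by rewrite trace2D addcharD.
  exact: addchar_norm.
(* Were [psi \o trace2] trivial, [sum_pairs] for [psi] of the first coordinate would read
   [0 + #|L| = 0]. *)
have [/existsP//|/existsPn triv] := boolP [exists z, psi (trace2 z) != 1].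
have := sum_pairs (fun w => psi w.1); rewrite /=.
under [X in _ + X]eq_bigr => z do rewrite (eqP (negbNE (triv z))).
under eq_bigr => p do rewrite addcharD //.
rewrite -(pair_bigA _ (fun x y => psi x * psi y)) -(pair_bigA _ (fun x y => psi x)) /=.
under eq_bigr => x do rewrite -mulr_sumr sum_addchar_id // mulr0.
rewrite sumr_const mul0rn add0r.
under [in RHS]eq_bigr do rewrite sumr_const.
rewrite [X in X = _]sumr_const sumrMnl sum_addchar_id // mul0rn mulr0 => /eqP.
by rewrite pnatr_eq0 cardL expn_eq0 /= (gtn_eqF (ltnW (finNzRing_gt1 E))).
Qed.

(** Hasse-Davenport in degree 2: [x + a / x + y + a / y] depends only on the sum and product of [x]
    and [y], and the trace of [z + a / z] is the same function of the trace and norm of [z]. Hence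
    both sums together are twice one sum over [E * E]. *)
Lemma kloosterman_quadratic a : a != 0 ->
  kloosterman (psi \o trace2) (i a) = 2 * Q%:R - kloosterman psi a ^+ 2.
Proof.
move=> a_neq0; pose g (w : E * E) := if w.2 != 0 then psi (w.1 + a * w.1 / w.2) else 0.
have KL : kloosterman (psi \o trace2) (i a) = \sum_z g (trace2 z, norm2 z).
  rewrite /kloosterman big_mkcond; apply: eq_bigr => z _ /=; rewrite /g norm2_eq0.
  by case: ifP => // z_neq0; rewrite trace2_kloosterman.
have KE : kloosterman psi a ^+ 2 = \sum_p g (p.1 + p.2, p.1 * p.2).
  rewrite expr2 /kloosterman big_distrlr /= pair_big /= big_mkcond.
  apply: eq_bigr => -[x y] _; rewrite /g /= mulf_eq0 negb_or.
  case: ifP => // /andP[x_neq0 y_neq0]; rewrite -addcharD //; congr (psi _).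
  by field; rewrite x_neq0 y_neq0.
rewrite KL KE; apply/eqP; rewrite -subr_eq opprK addrC sum_pairs; apply/eqP; congr (_ * _).
rewrite -(pair_bigA _ (fun s n => g (s, n))) exchange_big /=.
(* For fixed nonzero [n], the sum over [s] is a complete character sum of slope [1 + a / n]; only
   [n = - a] survives. *)
rewrite (bigD1 (- a)) //= [X in X + _](_ : _ = Q%:R).
  rewrite big1 ?addr0 // => n ne_na; rewrite /g /=; have [n0|n_neq0] := eqVneq n 0.
    by rewrite big1.
  transitivity (\sum_s psi ((1 + a / n) * s)).
    by apply: eq_bigr => s _; congr psi; ring.
  rewrite sum_addcharM // [_ == 0](_ : _ = false) ?muln0 //.
  apply: contraNF ne_na => /eqP/(congr1 ( *%R^~ n)).
  by rewrite mulrDl mul1r divfK // mul0r => /eqP; rewrite addrC addr_eq0 eq_sym eqr_oppLR eq_sym.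
transitivity (\sum_(s : E) (1 : algC)); last by rewrite sumr_const.
apply: eq_bigr => s _; rewrite /g /= oppr_eq0 a_neq0 -[RHS](addchar0 psiP); congr psi.
by field; rewrite oppr_eq0.
Qed.

End QuadraticExtension.

(** * Existence of characters and of quadratic extensions *)

Lemma card_pchar_nat (E : finFieldType) : [pchar E].-nat #|E|.
Proof.
have [p p_pr pE] := finPcharP E; rewrite (eq_pnat _ (pcharf_eq pE)).
by have := pprimeChar_pgroup pE; rewrite /pgroup cardsT.
Qed.

Lemma exists_additive_character (E : finFieldType) :
  exists psi : E -> algC, additive_character psi.
Proof.
have abE : abelian [set: E] := FinRing.zmod_abelian _.
have lin i : 'chi[[set: E]]_i \is a linear_char by have /char_abelianP := abE; apply.
have [i i_neq0] : exists i : Iirr [set: E], i != 0.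
  suff : (1 < #|Iirr [set: E]|)%N by rewrite (cardD1 0) inE ltnS => /card_gt0P[i /andP[]]; exists i.
  by rewrite card_Iirr_abelian // cardsT finNzRing_gt1.
exists 'chi_i; split=> [x y|x|].
- by rewrite -FinRing.zmodMgE lin_charM ?inE.
- by rewrite normC_lin_char ?inE.
apply/existsP; apply: contraNT i_neq0 => /existsPn chi1.
rewrite -irr_eq1; apply/eqP/cfunP => x; rewrite cfun1E inE.
exact/eqP/negPn/chi1.
Qed.

(** If every monic quadratic had a root, the map from pairs of roots to coefficients would be onto,
    hence injective by finiteness; but swapping two distinct roots gives the same coefficients. *)
Lemma exists_irreducible_quadratic (E : finFieldType) :
  exists2 p : {poly E}, size p = 3 & irreducible_poly p.
Proof.
pose pol (w : E * E) : {poly E} := 'X^2 + (w.1 *: 'X + w.2%:P).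
have szpol w : size (pol w) = 3%N.
  rewrite /pol size_polyDl size_polyXn // (leq_ltn_trans (size_polyD _ _)) //.
  rewrite gtn_max (leq_ltn_trans (size_scale_leq _ _)) ?size_polyX //.
  exact: leq_ltn_trans (size_polyC_leq1 _) _.
have [/existsP[w /forallP w_irr]|/existsPn split] :=
    boolP [exists w, forall x, ~~ root (pol w) x].
  by exists (pol w); rewrite ?szpol //; apply: cubic_irreducible; rewrite ?szpol.
pose h (p : E * E) := (- (p.1 + p.2), p.1 * p.2).

have h_surj w : exists p, h p = w.
  have /forallPn[x /negPn/rootP] := split w; case: w => b c.
  rewrite /pol /= !hornerE => rx; exists (x, - (b + x)); rewrite /h /=.
  apply/eqP; rewrite xpair_eqE; apply/andP; split; apply/eqP; first by ring.
  have {}rx : x ^+ 2 + b * x + c = 0 := rx.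
  by rewrite -[RHS]subr0 -rx; ring.
have h_inj : injective h.
  apply/injectiveP/card_uniqP; rewrite size_map -fintype.cardE; apply: eq_card => w.
  by have [p <-] := h_surj w; rewrite codom_f.
have /h_inj/eqP : h (0, 1) = h (1, 0) by rewrite /h /= mulr0 mul0r addrC.
by rewrite xpair_eqE eq_sym oner_eq0.
Qed.

Lemma exists_quadratic_extension (E : finFieldType) :
  exists (L : finFieldType) (i : {rmorphism E -> L}), #|L| = (#|E| ^ 2)%N.
Proof.
have [p szp /irredp_FAdjoin[L dimL _]] := exists_irreducible_quadratic E.
exists (FinFieldExtType L), (in_alg L : {rmorphism E -> FinFieldExtType L}).
have card_fullv := @card_vspace E (FinFieldExtType L) (Vector.class L) fullv.
have <- : \dim {:L} = 2%N by rewrite dimL szp.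
rewrite -[RHS]card_fullv.
exact/esym/(@card_vspacef E (FinFieldExtType L) (Vector.class L)).
Qed.

(** * Weil's bound by amplification *)

(** One level up, [(2 Q - K^2)^2 = 4 Q^2 + K^2 (K^2 - 4 Q)], and [K^2 >= Q (4 + y)] makes this at
    least [Q^2 (4 + 4 y)]. Invariance of [phi] under the Frobenius of the base field [E] persists
    since traces commute with it. *)
Lemma kloosterman_tower (E : finFieldType) (psi : E -> algC) (a : E) (x : algC) j :
    additive_character psi -> a != 0 -> 0 <= x ->
    kloosterman psi a ^+ 2 = #|E|%:R * (4 + x) ->
  exists (L : finFieldType) (phi : L -> algC) (b : L),
    [/\ additive_character phi, b != 0, forall y, phi (y ^+ #|E|) = phi y,
        [pchar L].-nat #|E| & #|L| = (#|E| ^ (2 ^ j))%N] /\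
    #|L|%:R * (4 + 4 ^+ j * x) <= kloosterman phi b ^+ 2.
Proof.
move=> psiP a_neq0 x_ge0 Kx.
elim: j => [|j [L [phi [b [[phiP b_neq0 phi_E E_pchar cardL] le_K]]]]].
  exists E, psi, a; split; last by rewrite Kx mul1r.
  by split=> // [y|]; rewrite ?expf_card // card_pchar_nat.
have [M [i cardM]] := exists_quadratic_extension L.
have M_pchar : [pchar M].-nat #|L|.
  by rewrite (eq_pnat _ (fmorph_pchar i)) card_pchar_nat.
exists M, (phi \o trace2 i), (i b); split.
  split; first exact: trace2_addchar.
  - by rewrite fmorph_eq0.
  - move=> y /=; rewrite -[RHS]phi_E; congr phi; apply: (fmorph_inj i).
    have E_M : [pchar M].-nat #|E| by rewrite (eq_pnat _ (fmorph_pchar i)).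
    rewrite rmorphXn !trace2E // exprDn_pchar //.
    by rewrite -!exprM [(#|L| * _)%N]mulnC.
  - by rewrite (eq_pnat _ (fmorph_pchar i)).
  by rewrite cardM cardL -expnM -expnSr.
rewrite kloosterman_quadratic // cardM natrX.
set K := kloosterman phi b in le_K *; set Q := #|L|%:R in le_K *; set y := 4 ^+ j * x in le_K.
have Q_ge0 : 0 <= Q by apply: ler0n.
have y_ge0 : 0 <= y by rewrite mulr_ge0 // exprn_ge0 // ler0n.
have -> : (2 * Q - K ^+ 2) ^+ 2 = 4 * Q ^+ 2 + K ^+ 2 * (K ^+ 2 - 4 * Q) by ring.
have -> : Q ^+ 2 * (4 + 4 ^+ j.+1 * x) = 4 * Q ^+ 2 + (Q * 4) * (Q * y).
  have -> : 4 ^+ j.+1 * x = 4 * y by rewrite exprS -mulrA.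
  ring.
rewrite lerD2l ler_pM ?(mulr_ge0 Q_ge0) ?ler0n //.
  by apply: le_trans le_K; rewrite ler_wpM2l // lerDl.
rewrite lerBrDr; apply: le_trans le_K; rewrite le_eqVlt; apply/orP; left; apply/eqP; ring.
Qed.

(* Going up a quadratic extension turns [K] into [2 Q - K^2], so an excess of
   [K^2 / Q] over 4 would grow without bound, against the Stepanov estimate. *)
Lemma kloosterman_weil (E : finFieldType) (psi : E -> algC) (a : E) :
  additive_character psi -> a != 0 -> kloosterman psi a ^+ 2 <= 4 * #|E|%:R.
Proof.
move=> psiP a_neq0; set q := #|E|; set K := kloosterman psi a.
have q_gt1 : (1 < q)%N := finNzRing_gt1 E.
have q_gt0 : 0 < (q%:R : algC) by rewrite ltr0n ltnW.
have K_real : K \is Num.real by apply: kloosterman_real.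
rewrite real_leNgt ?realX ?realM ?realn //; apply/negP => lt_K.
pose x := K ^+ 2 / q%:R - 4.
have x_gt0 : 0 < x by rewrite subr_gt0 ltr_pdivlMr.
have Kx : K ^+ 2 = q%:R * (4 + x) by rewrite /x; field; rewrite gt_eqF.
have bounded j : 4 ^+ j.+2 * x <= 25 * q%:R ^+ 2.
  have [L [phi [b [[phiP b_neq0 phi_E E_pchar cardL] le_K]]]] :=
    kloosterman_tower j.+2 psiP a_neq0 (ltW x_gt0) Kx.
  (* Level [j.+2] of the tower makes [s] at least 2, which [1 < q ^ s.-1] requires. *)
  pose s := (2 ^ j.+1)%N; have s_gt1 : (1 < s)%N by rewrite (ltn_exp2l 0).
  pose r := (q ^ s)%N.
  have rE : r = (q * q ^ s.-1)%N by rewrite -expnS prednK // ltnW.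
  have l_gt1 : (1 < q ^ s.-1)%N by rewrite -{1}(expn0 q) ltn_exp2l // -subn1 subn_gt0.
  have cardLr : #|L| = (r ^ 2)%N by rewrite cardL -expnM -expnSr.
  have r_pchar : [pchar L].-nat r by rewrite pnatX E_pchar.
  have q_le_r : (q <= r)%N by rewrite rE leq_pmulr // ltnW.
  have := kloosterman_stepanov b_neq0 q_gt1 l_gt1 rE r_pchar cardLr phiP phi_E.
  set Kb := kloosterman phi b in le_K *.
  have Kb_real : Kb \is Num.real by apply: kloosterman_real.
  (* The constant 25 in [bounded] is the square of this crude 5. *)
  have le5 : (2 * (r * q) + 2 * q + 1 <= 5 * (q * r))%N.
    have : (q * 1 <= q * r)%N by rewrite leq_mul2l (leq_trans _ q_le_r) ?orbT // ltnW.
    rewrite muln1 [(r * q)%N]mulnC; move: (q * r)%N => k; clear -q_gt1; lia.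
  move=> leKb; have {leKb} leKb : `|Kb| <= (5 * (q * r))%:R.
    by apply: le_trans leKb _; rewrite ler_nat.
  have r2_gt0 : 0 < ((r ^ 2)%:R : algC) by rewrite ltr0n expn_gt0 expn_gt0 ltnW.
  rewrite -(ler_pM2l r2_gt0); apply: le_trans (_ : Kb ^+ 2 <= _).
    apply: le_trans le_K; rewrite cardLr ler_pM2l // lerDr ler0n //.
  rewrite -real_normK //; apply: le_trans (_ : (5 * (q * r))%:R ^+ 2 <= _).
    by rewrite lerXn2r // nnegrE ?normr_ge0 ?ler0n.
  by rewrite !natrM natrX le_eqVlt; apply/orP; left; apply/eqP; ring.
pose B : algC := 25 * q%:R ^+ 2 / x.
have B_ge0 : 0 <= B by rewrite divr_ge0 ?(ltW x_gt0) // mulr_ge0 ?exprn_ge0 ?ler0n.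
have := archi_boundP B_ge0; set j := Num.bound _.
rewrite ltr_pdivrMr // => lt_j; have := le_lt_trans (bounded j) lt_j.
rewrite ltr_pM2r // -natrX ltr_nat ltnNge => /negP; apply.
by rewrite ltnW // (leq_trans (ltn_expl j (isT : (1 < 4)%N))) // leq_exp2l // leqW.
Qed.

(** * Fourier coefficients of the set of matrices of given determinant *)

Section DeterminantFibres.
Variable F : finFieldType.
Local Notation q := #|F|.

Definition mx22 (a b c d : F) : 'M[F]_2 :=
  \matrix_(i, j) if i == 0 then if j == 0 then a else b else if j == 0 then c else d.

Lemma mx22E a b c d :
  [/\ mx22 a b c d 0 0 = a, mx22 a b c d 0 1 = b, mx22 a b c d 1 0 = c & mx22 a b c d 1 1 = d].
Proof. by rewrite !mxE. Qed.

Lemma mx22K (A : 'M[F]_2) : mx22 (A 0 0) (A 0 1) (A 1 0) (A 1 1) = A.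
Proof.
apply/matrixP => i j; rewrite mxE.
by case: i => [[|[|//]] ?]; case: j => [[|[|//]] ?] /=; congr (A _ _); apply: val_inj.
Qed.

Lemma det_mx22 a b c d : \det (mx22 a b c d) = a * d - b * c.
Proof.
rewrite (expand_det_row _ 0) !big_ord_recl big_ord0 addr0 /cofactor !det_mx11 !mxE /=.
by rewrite expr0 expr1 !mul1r mulN1r mulrN.
Qed.

Lemma sum_mx22 (G : 'M[F]_2 -> algC) :
  \sum_A G A = \sum_a \sum_d \sum_b \sum_c
G (mx22 a b c d).
Proof.
pose h (w : (F * F) * (F * F)) := mx22 w.1.1 w.2.1 w.2.2 w.1.2.
have h_bij : bijective h.
  exists (fun A : 'M[F]_2 => ((A 0 0, A 1 1), (A 0 1, A 1 0))) => [[[a d] [b c]]|A].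
    by have [-> -> -> ->] := mx22E a b c d.
  exact: mx22K.
rewrite (reindex h) /=; last exact: onW_bij.
rewrite -(pair_bigA _ (fun u v => G (h (u, v)))) /=.
rewrite -(pair_bigA _ (fun a d => \sum_v G (h ((a, d), v)))) /=.
apply: eq_bigr => a _; apply: eq_bigr => d _.
by rewrite -(pair_bigA _ (fun b c => G (h ((a, d), (b, c))))).
Qed.

(** If the upper left entry [a] is nonzero, the determinant fixes the lower right one. If [a = 0],
    the latter is free and [b * c = - delta] has [q - 1] solutions. Diagonal entries suffice for
    [G], as traces against [pid_mx] see nothing else. *)
Lemma sum_det_fibre (G : F -> F -> algC) (delta : F) : delta != 0 ->
  \sum_(A : 'M[F]_2 | \det A == delta) G (A 0 0) (A 1 1) =
  \sum_(a | a != 0) \sum_b \sum_c G a ((delta + b * c) / a)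
    + (q%:R - 1) * \sum_d G 0 d.
Proof.
move=> delta_neq0; rewrite big_mkcond sum_mx22 /= (bigD1 0) //= addrC.
under [X in X + _]eq_bigr => a _ do under eq_bigr => d _ do
  under eq_bigr => b _ do under eq_bigr => c _ do
  [rewrite det_mx22; have [-> _ _ ->] := mx22E a b c d].
under [X in _ + X]eq_bigr => d _ do under eq_bigr => b _ do under eq_bigr => c _ do
  [rewrite det_mx22 mul0r sub0r; have [-> _ _ ->] := mx22E 0 b c d].
congr (_ + _).
  apply: eq_bigr => a a_neq0.
  rewrite exchange_big; apply: eq_bigr => b _; rewrite exchange_big; apply: eq_bigr => c _ /=.
  rewrite -big_mkcond (big_pred1 ((delta + b * c) / a)) // => d.
  by rewrite /= subr_eq -[RHS](inj_eq (mulIf a_neq0)) divfK // [d * a]mulrC.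
rewrite mulr_sumr; apply: eq_bigr => d _.
rewrite (bigD1 0) //= big1 ?add0r => [|c _]; last by rewrite mul0r oppr0 eq_sym (negPf delta_neq0).
transitivity (\sum_(b : F | b != 0) G 0 d).
  apply: eq_bigr => b b_neq0; rewrite -big_mkcond (big_pred1 (- (delta / b))) // => c /=.
  by rewrite eqr_oppLR -[RHS](inj_eq (mulIf b_neq0)) mulNr divfK // [c * b]mulrC.
rewrite sumr_const -[LHS]mulr_natl; have -> : #|[pred b : F | b != 0]| = q.-1 := cardC1 0.
by rewrite -subn1 natrB // ltnW // finNzRing_gt1.
Qed.

Variable psi : F -> algC.
Hypothesis psiP : additive_character psi.

Let q_gt0 : 0 < (q%:R : algC).
Proof. by rewrite ltr0n ltnW // finNzRing_gt1. Qed.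

Let sum_addchar_neq0 : \sum_(a | a != 0) psi a = -1.
Proof.
apply: (addrI (psi 0)); rewrite addchar0 // subrr.
by rewrite -[RHS](sum_addchar_id psiP) [RHS](bigD1 0) //= addchar0.
Qed.

Lemma card_det_fibre (delta : F) : delta != 0 ->
  \sum_(A : 'M[F]_2 | \det A == delta) 1 = q%:R * (q%:R ^+ 2 - 1) :> algC.
Proof.
move=> delta_neq0; rewrite (sum_det_fibre (fun _ _ => 1)) // !sumr_const.
have -> : #|[pred a : F | a != 0]| = q.-1 := cardC1 0.
rewrite -!mulrnA !natrM -subn1 natrB; last exact: ltnW (finNzRing_gt1 F).
ring.
Qed.

Lemma sum_det_fibre_rank1 (delta : F) : delta != 0 ->
  \sum_(A : 'M[F]_2 | \det A == delta) psi (A 0 0) = - q%:R.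
Proof.
move=> delta_neq0; rewrite (sum_det_fibre (fun a _ => psi a)) //.
under eq_bigr => a _ do rewrite !sumr_const -mulrnA -mulr_natl.
rewrite -mulr_sumr sum_addchar_neq0 addchar0 // sumr_const natrM; ring.
Qed.

Lemma sum_det_fibre_rank2 (delta : F) : delta != 0 ->
  \sum_(A : 'M[F]_2 | \det A == delta) psi (A 0 0 + A 1 1) =
  q%:R * kloosterman psi delta.
Proof.
move=> delta_neq0; rewrite (sum_det_fibre (fun a d => psi (a + d))) //.
under [X in _ + _ * X]eq_bigr => d _ do rewrite add0r.
rewrite sum_addchar_id // mulr0 addr0 mulr_sumr; apply: eq_bigr => a a_neq0.
(* The sum over [c] is complete of slope [b / a], so only [b = 0] contributes, with weight [q]. *)
transitivity (\sum_b psi (a + delta / a) * \sum_c psi (b / a * c)).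
  apply: eq_bigr => b _; rewrite mulr_sumr; apply: eq_bigr => c _.
  by rewrite -addcharD //; congr psi; ring.
rewrite -mulr_sumr mulrC; congr (_ * _); rewrite (bigD1 0) //= [X in _ + X]big1 => [|b b_neq0].
  by rewrite sum_addcharM // mul0r eqxx muln1 addr0.
by rewrite sum_addcharM // mulf_eq0 invr_eq0 (negPf b_neq0) (negPf a_neq0) muln0.
Qed.

Lemma pid_mx22_trace (A : 'M[F]_2) :
  \tr (pid_mx 1 *m A) = A 0 0 /\ \tr (pid_mx 2 *m A) = A 0 0 + A 1 1.
Proof.
split; rewrite /mxtrace !big_ord_recl big_ord0 !mxE !big_ord_recl !big_ord0 !mxE /=.
  by rewrite !mul1r !mul0r !addr0.
have -> : lift ord0 ord0 = 1 :> 'I_2 by apply: val_inj.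
by rewrite !mul1r !mul0r !(addr0, add0r).
Qed.

(** Writing [B] as [P *m pid_mx (\rank B) *m R] and substituting [R *m A *m P] for the variable
    reduces [B] to its rank normal form, at the price of scaling the determinant by a nonzero
    factor. *)
Lemma fourier_det_le (B : 'M[F]_2) (alpha : F) : B != 0 -> alpha != 0 ->
  `|\sum_(A : 'M[F]_2 | \det A == alpha) psi (\tr (B *m A))| ^+ 2 <= 4 * q%:R ^+ 3.
Proof.
move=> B_neq0 alpha_neq0.
pose P := col_ebase B; pose R := row_ebase B.
have [uP uR] : P \in unitmx /\ R \in unitmx by rewrite col_ebase_unit row_ebase_unit.
pose delta := \det R * alpha * \det P.
have delta_neq0 : delta != 0.
  by rewrite !mulf_neq0 // -unitfE -unitmxE.
have -> : \sum_(A : 'M[F]_2 | \det A == alpha) psi (\tr (B *m A)) =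
    \sum_(A : 'M[F]_2 | \det A == delta) psi (\tr (pid_mx (\rank B) *m A)).
  rewrite [RHS](reindex (fun A => R *m A *m P)); last first.
    exists (fun A => invmx R *m A *m invmx P) => A _.
      by rewrite -!mulmxA mulmxV // mulmx1 mulKmx.
    by rewrite !mulmxA mulmxV // mul1mx -mulmxA mulVmx // mulmx1.
  apply: eq_big => A; last first.
    by move=> _; rewrite -{1}(mulmx_ebase B) -!mulmxA mxtrace_mulC !mulmxA.
  rewrite !det_mulmx /delta.
  rewrite (inj_eq (mulIf _)) -?unitfE -?unitmxE // (inj_eq (mulfI _)) //.
  by rewrite -unitfE -unitmxE.
have [r1 | r2] : \rank B = 1%N \/ \rank B = 2%N.
  have := rank_leq_row B; have : \rank B != 0%N by rewrite mxrank_eq0.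
  by case: (\rank B) => [|[|[|]]] //; [left | right].
  rewrite r1; under eq_bigr => A _ do rewrite (pid_mx22_trace A).1.
  rewrite sum_det_fibre_rank1 // normrN normr_nat.
  rewrite -!natrX -natrM ler_nat expnS mulnA leq_pmull // muln_gt0 /=.
  exact: ltnW (finNzRing_gt1 F).
rewrite r2; under eq_bigr => A _ do rewrite (pid_mx22_trace A).2.
rewrite sum_det_fibre_rank2 // normrM normr_nat exprMn real_normK; last exact: kloosterman_real.
have /(ler_wpM2l (exprn_ge0 2 (ltW q_gt0))) := kloosterman_weil psiP delta_neq0.
by move=> le; apply: le_trans le _; rewrite le_eqVlt; apply/orP; left; apply/eqP; ring.
Qed.

End DeterminantFibres.

(** * Fourier analysis on 2 by 2 matrices and the avoidance bound *)

(** Termwise weighted AM-GM; the weights [s / n] and [n / s] make both sums of squares contribute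
    [C * s]. *)
Lemma cauchy_schwarz_norm (I : finType) (f g : I -> algC) (n m C s : algC) :
    0 < n -> 0 < m -> 0 < s -> s ^+ 2 = n * m ->
    \sum_i `|f i| ^+ 2 = C * n -> \sum_i `|g i| ^+ 2 = C * m ->
  \sum_i `|f i| * `|g i| <= C * s.
Proof.
move=> n_gt0 m_gt0 s_gt0 s2 fn gm.
have ns_neq0 : (n != 0) /\ (s != 0) by rewrite !gt_eqF.
have le i : `|f i| * `|g i| <= (s / n * `|f i| ^+ 2 + n / s * `|g i| ^+ 2) / 2.
  rewrite ler_pdivlMr // -subr_ge0.
  rewrite [leRHS](_ : _ = s / n * (`|f i| - n / s * `|g i|) ^+ 2).
    have [sn ns] : 0 <= s / n /\ 0 <= n / s by rewrite !divr_ge0 // ltW.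
    apply: mulr_ge0 => //; rewrite -realEsqr; apply: realB (normr_real _) _.
    exact: ger0_real (mulr_ge0 ns (normr_ge0 _)).
  by field; rewrite !gt_eqF.
apply: le_trans (ler_sum _ (fun i _ => le i)) _.
rewrite -mulr_suml big_split /= -!mulr_sumr fn gm le_eqVlt; apply/orP; left; apply/eqP.
have -> : m = s ^+ 2 / n by rewrite s2; field; rewrite gt_eqF.
by field; rewrite !gt_eqF.
Qed.

Section MatrixFourier.
Variables (F : finFieldType) (psi : F -> algC).
Hypothesis psiP : additive_character psi.
Local Notation q := #|F|.

Lemma sum_addchar_trace (Z : 'M[F]_2) :
  \sum_B psi (\tr (B *m Z)) = (q ^ 4 * (Z == 0))%:R.
Proof.
have [->|Z_neq0] := eqVneq Z 0.
  under eq_bigr => B _ do rewrite mulmx0 mxtrace0 addchar0 //.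
  by rewrite sumr_const card_mx muln1.
rewrite muln0; apply: sum_addchar => // [B C|]; first by rewrite mulmxDl mxtraceD.
have [i [j Zij]] := matrix0Pn Z Z_neq0.
(* [delta_mx j i] extracts the entry [Z i j] from the trace, so this witness has trace [x]. *)
have [_ _ [x psi_x]] := psiP; exists ((x / Z i j) *: delta_mx j i).
rewrite -scalemxAl mxtraceZ (_ : \tr _ = Z i j) ?divfK //.
rewrite /mxtrace (bigD1 j) //= big1 ?addr0 => [|k ne_kj]; rewrite mxE.
  rewrite (bigD1 i) //= mxE !eqxx mul1r big1 ?addr0 // => l ne_li.
  by rewrite mxE (negPf ne_li) andbF mul0r.
by rewrite big1 // => l _; rewrite mxE (negPf ne_kj) mul0r.
Qed.

Definition fourier (X : {set 'M[F]_2}) B := \sum_(M in X) psi (\tr (B *m M)).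

Lemma fourier_conj X B : (fourier X B)^* = \sum_(M in X) psi (\tr (B *m - M)).
Proof.
rewrite rmorph_sum; apply: eq_bigr => M _.
by rewrite mulmxN raddfN addcharN.
Qed.

Lemma fourier_plancherel X : \sum_B `|fourier X B| ^+ 2 = q%:R ^+ 4 * #|X|%:R.
Proof.
transitivity (\sum_(M in X) \sum_(N in X) \sum_B psi (\tr (B *m (M - N)))).
  rewrite [RHS](eq_bigr (fun M => \sum_B \sum_(N in X) psi (\tr (B *m (M - N))))); last first.
    by move=> M _; rewrite exchange_big.
  rewrite exchange_big; apply: eq_bigr => B _.
  rewrite normCK fourier_conj mulr_suml; apply: eq_bigr => M _.
  rewrite mulr_sumr; apply: eq_bigr => N _.
  by rewrite mulmxDr mxtraceD addcharD.
rewrite -natrX -natrM mulnC natrM -[#|X|%:R]sumr_const mulr_suml; apply: eq_bigr => M XM.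
rewrite (bigD1 M) //= sum_addchar_trace subrr eqxx muln1 big1 ?addr0 ?mul1r // => N /andP[_ ne].
by rewrite sum_addchar_trace subr_eq0 eq_sym (negPf ne) muln0.
Qed.

(** By orthogonality the sum is [q ^ 4] times the number of triples with [A = M - N] and
    [\det A = alpha], and there are none. *)
Lemma fourier_no_pair (X Y : {set 'M[F]_2}) alpha :
    (forall M N, M \in X -> N \in Y -> \det (M - N) != alpha) ->
  \sum_B (\sum_(A : 'M[F]_2 | \det A == alpha) psi (\tr (B *m A))) *
    ((fourier X B)^* * fourier Y B) = 0.
Proof.
move=> noXY.
transitivity (\sum_(A : 'M[F]_2 | \det A == alpha) \sum_(M in X) \sum_(N in Y)
                \sum_B psi (\tr (B *m (A - M + N)))).
  transitivity (\sum_B \sum_(A : 'M[F]_2 | \det A == alpha) \sum_(M in X) \sum_(N in Y)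
                 psi (\tr (B *m (A - M + N)))).
    apply: eq_bigr => B _; rewrite mulr_suml; apply: eq_bigr => A _.
    rewrite fourier_conj mulr_suml mulr_sumr; apply: eq_bigr => M _.
    rewrite !mulr_sumr; apply: eq_bigr => N _.
    by rewrite !mulmxDr !mxtraceD !addcharD // mulrA.
  rewrite exchange_big; apply: eq_bigr => A _; rewrite exchange_big; apply: eq_bigr => M _.
  by rewrite exchange_big.
apply: big1 => A /eqP detA; apply: big1 => M XM; apply: big1 => N YN.
rewrite sum_addchar_trace [_ == 0](_ : _ = false) ?muln0 //.
apply: contraNF (noXY M N XM YN) => /eqP AMN; rewrite -detA; apply/eqP; congr (\det _).
by apply/eqP; rewrite -subr_eq0 -oppr_eq0 -AMN; apply/eqP; rewrite !opprB addrA addrAC.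
Qed.

End MatrixFourier.

Lemma card_det_avoiding (F : finFieldType) (X Y : {set 'M[F]_2}) (alpha : F) :
    alpha != 0 ->
    (forall M N, M \in X -> N \in Y -> \det (M - N) != alpha) ->
  sqrtC (#|X| * #|Y|)%:R <=
    2 * #|F|%:R ^+ 3 * sqrtC #|F|%:R / (#|F|%:R - 1) :> algC.
Proof.
move=> alpha_neq0 noXY; have [psi psiP] := exists_additive_character F.
set Q : algC := #|F|%:R; set s := sqrtC _; set w := sqrtC Q.
have q_gt1 : 1 < Q by rewrite ltr1n finNzRing_gt1.
have q_gt0 : 0 < Q := lt_trans ltr01 q_gt1.
have q1_gt0 : 0 < Q - 1 by rewrite subr_gt0.
have w_gt0 : 0 < w by rewrite sqrtC_gt0.
have w2 : w ^+ 2 = Q by apply: sqrtCK.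
have rhs_ge0 : 0 <= 2 * Q ^+ 3 * w / (Q - 1).
  by rewrite divr_ge0 ?(ltW q1_gt0) // !mulr_ge0 ?exprn_ge0 ?ler0n ?(ltW w_gt0).
have s_ge0 : 0 <= s by rewrite sqrtC_ge0 ler0n.
have [s0|s_neq0] := eqVneq s 0; first by rewrite s0.
have s_gt0 : 0 < s by rewrite lt_def s_neq0.
have s2 : s ^+ 2 = #|X|%:R * #|Y|%:R by rewrite sqrtCK natrM.
have [X_gt0 Y_gt0] : 0 < #|X|%:R :> algC /\ 0 < #|Y|%:R :> algC.
  have : s ^+ 2 != 0 by rewrite sqrf_eq0.
  by rewrite s2 mulf_eq0 negb_or !pnatr_eq0 -!lt0n !ltr0n => /andP.
pose lam B := \sum_(A : 'M[F]_2 | \det A == alpha) psi (\tr (B *m A)).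
have lam_le B : B != 0 -> `|lam B| <= 2 * Q * w.
  move=> B_neq0; rewrite -(ler_pXn2r (n := 2)) // ?nnegrE ?normr_ge0 //; last first.
    by rewrite !mulr_ge0 ?ler0n ?(ltW w_gt0).
  rewrite !exprMn w2; apply: le_trans (fourier_det_le psiP B_neq0 alpha_neq0) _.
  by rewrite le_eqVlt; apply/orP; left; apply/eqP; rewrite -/Q; ring.
have lam0 : lam 0 = Q * (Q ^+ 2 - 1).
  rewrite -(card_det_fibre alpha_neq0); apply: eq_bigr => A _.
  by rewrite mul0mx mxtrace0 addchar0.
have four0 Z : fourier psi Z 0 = #|Z|%:R.
  by rewrite -sumr_const; apply: eq_bigr => A _; rewrite mul0mx mxtrace0 addchar0.
have := fourier_no_pair psiP noXY; rewrite (bigD1 0) //= -/(lam 0) lam0 !four0 conjC_nat -s2.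
move/eqP; rewrite addr_eq0 => /eqP main.
have : Q * (Q ^+ 2 - 1) * s ^+ 2 <= 2 * Q * w * (Q ^+ 4 * s).
  have lhs_ge0 : 0 <= Q * (Q ^+ 2 - 1) * s ^+ 2.
    by rewrite !mulr_ge0 ?exprn_ge0 ?ler0n // subr_ge0 exprn_ege1 // ltW.
  rewrite -(ger0_norm lhs_ge0) main normrN; apply: le_trans (ler_norm_sum _ _ _) _.
  apply: le_trans (_ : \sum_B 2 * Q * w * (`|fourier psi X B| * `|fourier psi Y B|) <= _).
    (* The term at [B = 0] is put back into the majorant, where it is nonnegative, so that
       Plancherel applies to full sums. *)
    rewrite [leRHS](bigD1 0) //= -[leLHS]add0r lerD //.
      by rewrite !mulr_ge0 ?ler0n ?(ltW w_gt0).
    apply: ler_sum => B B_neq0; rewrite !normrM norm_conjC ler_wpM2r ?mulr_ge0 //.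
    exact: lam_le.
  rewrite -mulr_sumr ler_wpM2l //; first by rewrite !mulr_ge0 ?ler0n ?(ltW w_gt0).
  by apply: (cauchy_schwarz_norm X_gt0 Y_gt0 s_gt0 s2); apply: fourier_plancherel.
move=> le; rewrite ler_pdivlMr //.
have Qs_gt0 : 0 < Q * s * (Q + 1) by rewrite !mulr_gt0 // addr_gt0.
(* The estimate amounts to [s <= 2 Q^4 w / (Q^2 - 1)]; replacing one factor [Q] by [Q + 1] cancels
   against [Q^2 - 1] and yields the stated constant. *)
rewrite -(ler_pM2l Qs_gt0).
apply: le_trans (_ : 2 * Q * w * (Q ^+ 4 * s) <= _).
  by apply: le_trans le; rewrite le_eqVlt; apply/orP; left; apply/eqP; ring.
rewrite -subr_ge0 [leRHS](_ : _ = 2 * Q ^+ 4 * w * s); last ring.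
by rewrite !mulr_ge0 ?exprn_ge0 ?ler0n ?(ltW w_gt0).
Qed.

(* Mat_2(F_q) = 'M[F]_2 with F a finite field, q = #|F|.
   Real quantities are computed in algC (algebraic complex numbers, which
   contain the real algebraic numbers with their usual order and sqrtC). *)
Theorem theorem1p1 (F : finFieldType) (alpha : F) (halpha : alpha != 0) :
  (forall X Y : {set 'M[F]_2},
     sqrtC ((#|X| * #|Y|)%:R : algC) >
       2 * (#|F|%:R) ^+ 3 * sqrtC (#|F|%:R) / (#|F|%:R - 1) ->
     exists M, exists N, [/\ M \in X, N \in Y & \det (M - N) = alpha])
  /\
  (forall X : {set 'M[F]_2},
     (#|X|%:R : algC) > 2 * (#|F|%:R) ^+ 3 * sqrtC (#|F|%:R) / (#|F|%:R - 1) ->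
     exists M, exists N, [/\ M \in X, N \in X, M != N & \det (M - N) = alpha]).
Proof.
have exXY (X Y : {set 'M[F]_2}) :
    sqrtC ((#|X| * #|Y|)%:R : algC) >
      2 * (#|F|%:R) ^+ 3 * sqrtC (#|F|%:R) / (#|F|%:R - 1) ->
    exists M, exists N, [/\ M \in X, N \in Y & \det (M - N) = alpha].
  move=> bigXY; case: (boolP [exists M, exists N, [&& M \in X, N \in Y & \det (M - N) == alpha]]).
    by case/existsP=> M /existsP[N /and3P[XM YN /eqP detMN]]; exists M, N.
  move=> noXY; suff /(lt_le_trans bigXY) : sqrtC ((#|X| * #|Y|)%:R : algC) <=
      2 * (#|F|%:R) ^+ 3 * sqrtC (#|F|%:R) / (#|F|%:R - 1) by rewrite ltxx.
  apply: (card_det_avoiding halpha) => M N XM YN; apply: contraNN noXY => detMN.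
  by apply/existsP; exists M; apply/existsP; exists N; rewrite XM YN.
split=> // X bigX; have [|M [N [XM XN detMN]]] := exXY X X.
  by rewrite mulnn natrX sqrCK ?ler0n.
exists M, N; split=> //; apply: contraNneq halpha => eqMN.
by rewrite -detMN eqMN subrr det0.
Qed.
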